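(* Let $T$ be a tree of order $n$, with $\ell$ leaves and $s$ support vertices. Then $$\gamma(T)\leq \frac{n-\ell+2s}{3},$$ and this bound is sharp.
   Context: Graphs are finite, simple and undirected. The order of $T$ is its number of vertices. A leaf of $T$ is a vertex of degree $1$, and a support vertex is a vertex having at least one leaf in its neighborhood. A set $S\subseteq V(T)$ is a dominating set if each vertex in $V(T)\setminus S$ is adjacent to at least one vertex in $S$; the domination number $\gamma(T)$ is the minimum cardinality of a dominating set in $T$. ''Sharp'' means that equality is attained.
   Formalization: The tree is assumed to have order n ≥ 2, because for the one-vertex tree γ = 1 and ℓ = s = 0, so the stated bound would read 1 ≤ 1/3, which is false. *)

(* Defs.v *)
From mathcomp Require Import all_boot all_order all_algebra.
Set Implicit Arguments.
Unset Strict Implicit.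
Unset Printing Implicit Defensive.

Structure sgraph := SGraph {
  vertex :> finType;
  adj : rel vertex;
  adj_sym : symmetric adj;
  adj_irr : irreflexive adj }.

Section Graphs.
Variable G : sgraph.
Implicit Types (x y : G) (S : {set G}).

Definition order_of : nat := #|G|.

Definition neighbors x : {set G} := [set y | adj x y].

Definition degree x : nat := #|neighbors x|.

Definition connected_graph : Prop := forall x y, connect (@adj G) x y.

(* [ucycle] also accepts the empty sequence and [:: x; y] with x adjacent to y,
   neither of which is a cycle of a simple graph. *)
Definition acyclic : Prop :=
  forall c : seq G, ucycle (@adj G) c -> size c < 3.

Definition tree : Prop := [/\ 0 < order_of, connected_graph & acyclic].

Definition leaves : {set G} := [set x | degree x == 1].

Definition support_vertices : {set G} :=
  [set x | [exists y in neighbors x, y \in leaves]].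

Definition dominating : pred {set G} :=
  fun S => [forall x, (x \notin S) ==> [exists y in S, adj x y]].

(* The default value [set: G] is dominating, so this is a genuine minimum. *)
Definition domination_number : nat :=
  #|[arg min_(S < [set: G] | dominating S) #|S|]|.

End Graphs.

(* Main.v *)
(** Root the tree at a leaf and let [R] be the set of vertices that are neither
    leaves nor support vertices.  The support vertices dominate everything except
    the vertices of [R] all of whose neighbours are again in [R]; such a vertex
    has a parent and a child, so its closed neighbourhood in [R] meets all three
    classes of the depth modulo 3.  Adding the smallest class of [R] to the
    support vertices gives a dominating set of size at most [s + (n - l - s) / 3].
    The count uses that leaves are not support vertices, which fails only for the
    tree with two vertices.  The bound is attained by the path on three vertices. *)
Require Import Defs.
From mathcomp Require Import all_boot all_order all_algebra.
From mathcomp Require Import zify lra.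
Import Order.TTheory GRing.Theory Num.Theory.
Local Open Scope ring_scope.

(** * Depth from a root, parents and children in a tree *)

Section Depth.
Set Implicit Arguments.
Unset Strict Implicit.
Local Open Scope nat_scope.
Variable G : sgraph.
Implicit Types (r x y v : G) (S : {set G}) (d : G -> nat).

(** In a connected graph these local conditions determine [d] as the distance to [r]; the third one
    provides a parent. *)
Definition is_depth r d : Prop :=
  [/\ forall v, (d v == 0) = (v == r),
      forall x y, adj x y -> d y <= (d x).+1
    & forall v, v != r -> exists2 u, adj v u & d v = (d u).+1].

(** Take for [d v] the length of a shortest walk from [r] to [v]; the vertex before [v] on it is a
    parent. Walks are tuples so that [P v n] is boolean, as [ex_minn] requires. *)
Lemma connected_depth r : connected_graph G -> exists d, is_depth r d.
Proof.
move=> connG.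
pose P v n := [exists p : n.-tuple G, path (@adj G) r p && (last r p == v)].
have PI v (p : seq G) : path (@adj G) r p -> last r p = v -> P v (size p).
  by move=> pth lst; apply/existsP; exists (in_tuple p); rewrite /= pth lst eqxx.
have exP v : exists n, P v n.
  by have /connectP[p pth lst] := connG r v; exists (size p); apply: PI.
pose d v := ex_minn (exP v).
have dP v : exists p, [/\ path (@adj G) r p, last r p = v & size p = d v].
  rewrite /d; case: ex_minnP => n /existsP[p /andP[pth /eqP lst]] _.
  by exists p; rewrite size_tuple.
have d_le v p : path (@adj G) r p -> last r p = v -> d v <= size p.
  by move=> pth lst; rewrite /d; case: ex_minnP => n _; apply; apply: PI.
have d_adj x y : adj x y -> d y <= (d x).+1.
  move=> xy; have [p [pth lst <-]] := dP x.
  by rewrite -(size_rcons p y) d_le ?last_rcons // rcons_path pth lst.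
exists d; split=> // v.
  apply/eqP/eqP => [|->]; first by have [p [_ <- <-]] := dP v => /size0nil ->.
  by apply/eqP; rewrite -leqn0 (d_le r [::]).
have [p [pth lst sz]] := dP v; case/lastP: p pth lst sz => [|p w].
  by move=> _ <- _; rewrite eqxx.
rewrite rcons_path last_rcons size_rcons => /andP[pth uw] wv sz _.
move: uw sz; rewrite {w}wv => uv sz.
exists (last r p); first by rewrite adj_sym.
have := d_le _ p pth erefl; have := d_adj _ _ uv; lia.
Qed.

(* Descending from [x] to the root only meets depths smaller than [d x]. *)
Lemma connect_root_avoiding r d v x :
  is_depth r d -> d x <= d v -> x != v ->
  connect [rel a b | [&& adj a b, a != v & b != v]] x r.
Proof.
move=> [_ _ par]; have [n] := ubnP (d x); elim: n x => // n IH x lt_n le_v xv.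
have [-> //|xr] := eqVneq x r.
have [u xu du] := par x xr.
have uv : u != v by apply: contra_eq_neq du => ->; lia.
apply: (@connect_trans _ _ u); first by apply: connect1; rewrite /= xu xv uv.
by apply: IH; lia.
Qed.

(** If [x] and [y] differed, walks from both to the root avoiding [v] would join them, and [v] would
    close a cycle. *)
Lemma acyclic_parent_uniq r d v x y :
  acyclic G -> is_depth r d -> adj v x -> adj v y ->
  d x <= d v -> d y <= d v -> x = y.
Proof.
move=> acG dP vx vy dx dy; apply/eqP; apply: contraT => xy.
have neqv z : adj v z -> z != v by apply: contraTneq => ->; rewrite adj_irr.
set e := [rel a b | [&& adj a b, a != v & b != v]].
have e_sym : connect_sym e.
  by apply: sym_connect_sym => a b; rewrite /= adj_sym [(a != v) && _]andbC.
have : connect e x y.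
  apply: connect_trans (connect_root_avoiding dP dx (neqv _ vx)) _.
  by rewrite e_sym; apply: connect_root_avoiding dP dy (neqv _ vy).
case/connectP=> p0 /shortenP[p pth up _] lst.
(* All vertices of [p] avoid [v], so [v :: x :: p] is a cycle; the size bound then leaves [p] empty,
   that is [x = y]. *)
have : size (v :: x :: p) < 3.
  apply: acG; apply/andP; split; last first.
    rewrite /= inE negb_or eq_sym neqv //= -/(uniq (x :: p)) up andbT.
    elim: p x {vx dx xy up lst} pth => //= b p IH a /andP[/and3P[_ _ bv] /IH].
    by rewrite inE eq_sym negb_or bv.
  rewrite /= rcons_path vx -lst adj_sym vy andbT.
  by apply: sub_path pth => a b /and3P[].
case: p pth lst {up} => //= _ yx; by rewrite yx eqxx in xy.
Qed.

(** One neighbour is the parent; another one that is not deeper than [v] would equal it by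
    [acyclic_parent_uniq]. *)
Lemma acyclic_child r d v :
  acyclic G -> is_depth r d -> v != r -> 1 < degree v ->
  exists2 w, adj v w & d w = (d v).+1.
Proof.
move=> acG dP vr; have [_ d_adj par] := dP; have [u vu du] := par v vr.
rewrite /degree (cardsD1 u) inE vu ltnS card_gt0 => /set0Pn[w].
rewrite !inE => /andP[wu vw]; exists w => //.
apply/eqP; rewrite eqn_leq d_adj //= ltnNge; apply: contra wu => dw.
by apply/eqP; apply: (acyclic_parent_uniq acG dP vw vu dw); rewrite du.
Qed.

Lemma connected_degree_gt0 v : connected_graph G -> 1 < order_of G -> 0 < degree v.
Proof.
move=> connG n_gt1; have : 0 < #|[set~ v]|.
  by rewrite cardsC1 -subn1 subn_gt0.
rewrite card_gt0 => /set0Pn[x]; rewrite !inE => xv.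
have /connectP[[|y p] /= pth lst] := connG v x; first by rewrite lst eqxx in xv.
by rewrite card_gt0; apply/set0Pn; exists y; rewrite inE; case/andP: pth.
Qed.

(** A vertex of maximal depth has no child, so its degree cannot exceed 1. *)
Lemma tree_has_leaf : tree G -> 1 < order_of G -> exists r, r \in leaves G.
Proof.
move=> [n_gt0 connG acG] n_gt1; have [x0 _] := card_gt0P n_gt0.
have [d dP] := connected_depth x0 connG.
have [v _ v_max] := @arg_maxnP _ x0 xpredT d isT.
exists v; rewrite inE eqn_leq connected_degree_gt0 // andbT leqNgt.
apply/negP => deg2.
have [d0 _ _] := dP.
(* The root has a neighbour, whose depth is positive, so the root is not deepest. *)
have vx0 : v != x0.
  have : 0 < degree x0 by apply: connected_degree_gt0.
  rewrite card_gt0 => /set0Pn[w]; rewrite inE => x0w.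
  have wx0 : w != x0 by apply: contraTneq x0w => ->; rewrite adj_irr.
  by rewrite -d0 -lt0n (leq_trans _ (v_max w isT)) // lt0n d0.
have [w _ dw] := acyclic_child acG dP vx0 deg2.
by have := v_max w isT; rewrite /= dw ltnn.
Qed.

End Depth.

(** * Leaves, support vertices and the domination bound *)

Section Domination.
Set Implicit Arguments.
Unset Strict Implicit.
Local Open Scope nat_scope.
Variable G : sgraph.
Implicit Types (r x y v : G) (S : {set G}).

Lemma dominating_setT : dominating [set: G].
Proof. by apply/forallP => x; rewrite inE. Qed.

Lemma domination_number_le S : dominating S -> domination_number G <= #|S|.
Proof.
move=> domS; rewrite /domination_number.
by case: arg_minnP => [|? _]; [apply: dominating_setT|apply].
Qed.

Lemma domination_number_gt0 : 0 < order_of G -> 0 < domination_number G.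
Proof.
case/card_gt0P=> x _; rewrite /domination_number.
case: arg_minnP => [|S /forallP domS _]; first exact: dominating_setT.
rewrite card_gt0; apply/set0Pn; have := domS x.
by have [|_ /existsP[y /andP[]]] := boolP (x \in S); [exists x|exists y].
Qed.

Lemma leaf_neighborsE x y : x \in leaves G -> adj x y -> neighbors x = [set y].
Proof.
rewrite inE => /cards1P[z xz] xy.
by have : y \in neighbors x; [rewrite inE | rewrite xz => /set1P ->].
Qed.

(** The pair is closed under adjacency, and the graph is connected. *)
Lemma adjacent_leaves_cover x y :
  connected_graph G -> x \in leaves G -> y \in leaves G -> adj x y ->
  [set: G] = [set x; y].
Proof.
move=> connG lx ly xy; have yx : adj y x by rewrite adj_sym.
apply/setP => z; rewrite in_setT; apply/esym.
have /connectP[p pth ->] := connG x z.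
suff xyP (a : G) (q : seq G) :
    a \in [set x; y] -> path (@adj G) a q -> last a q \in [set x; y].
  by apply: xyP pth; rewrite !inE eqxx.
elim: q a => //= b q IH a /set2P[] ax /andP[ab]; apply: IH.
  have : b \in neighbors x by rewrite inE -ax.
  by rewrite (leaf_neighborsE lx xy) !inE orbC => ->.
have : b \in neighbors y by rewrite inE -ax.
by rewrite (leaf_neighborsE ly yx) !inE => ->.
Qed.

(** Averaging: the three residue classes partition [A], so the smallest holds at most a third of
    it. *)
Lemma smallest_class3 (A : {set G}) (d : G -> nat) :
  exists2 i, i < 3 & 3 * #|[set v in A | d v %% 3 == i]| <= #|A|.
Proof.
have cardA : \sum_(i < 3) #|[set v in A | d v %% 3 == i]| = #|A|.
  rewrite -sum1_card.
  rewrite (partition_big (fun v => Ordinal (ltn_pmod (d v) (isT : 0 < 3))) xpredT) //.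
  apply: eq_bigr => i _; rewrite -sum1_card; apply: eq_bigl => v.
  by rewrite !inE.
have [i _ i_min] :=
  @arg_minnP _ (ord0 : 'I_3) xpredT (fun i => #|[set v in A | d v %% 3 == i]|) isT.
exists i => //; rewrite -cardA -{1}[3]card_ord -sum_nat_const.
by apply: leq_sum => j _; apply: i_min.
Qed.

(** This form avoids division and truncated subtraction in [nat]. *)
Lemma tree_domination_bound :
  tree G -> 1 < order_of G ->
  3 * domination_number G + #|leaves G| <= order_of G + 2 * #|support_vertices G|.
Proof.
move=> treeG n_gt1; have [_ connG acG] := treeG.
set L := leaves G; set W := support_vertices G.
have WI x y : adj x y -> y \in L -> x \in W.
  by move=> xy ly; rewrite inE; apply/existsP; exists y; rewrite inE xy.
(* A leaf that is a support vertex forces the two-vertex tree, where one vertex dominates and [W] is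
   everything. *)
have [/existsP[x /andP[lx]]|disj] := boolP [exists x, (x \in L) && (x \in W)].
  rewrite inE => /existsP[y]; rewrite inE => /andP[xy ly].
  have yx : adj y x by rewrite adj_sym.
  have GE := adjacent_leaves_cover connG lx ly xy.
  have dom1 : domination_number G <= 1.
    rewrite -(cards1 x); apply: domination_number_le; apply/forallP => z.
    have : z \in [set: G] by rewrite inE.
    rewrite GE => /set2P[] ->; apply/implyP; first by rewrite inE eqxx.
    by move=> _; apply/existsP; exists x; rewrite inE eqxx.
  have WT : W = [set: G].
    apply/eqP; rewrite eqEsubset subsetT GE subUset !sub1set.
    by rewrite (WI x y) // (WI y x).
  have : #|L| <= order_of G by apply: max_card.
  by rewrite WT cardsT; move: n_gt1; rewrite /order_of; lia.
have {}disj : L :&: W = set0.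
  apply/setP => x; rewrite !in_setI in_set0.
  by apply: contraNF disj => xLW; apply/existsP; exists x.
(* Rooting at a leaf keeps the root out of [R], so every vertex of [R] has a parent. *)
have [r rL] := tree_has_leaf treeG n_gt1.
have [d dP] := connected_depth r connG; have [_ _ par] := dP.
pose R := ~: (L :|: W).
have cardR : #|L| + #|W| + #|R| = order_of G.
  by rewrite -[#|L| + _]subn0 -(cards0 G) -disj -cardsU cardsC.
have [i i_lt3 leR] := smallest_class3 R d.
set C := [set v in R | _] in leR.
(* By [leR] and [cardR], [3 * (#|W| + #|C|)] is at most [3 * #|W| + #|R|], which equals
   [order_of G - #|L| + 2 * #|W|]. *)
suff domS : dominating (W :|: C).
  have := domination_number_le domS; have [leWC _] := leq_card_setU W C; lia.
apply/forallP => v; apply/implyP => vS.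
have vW : v \notin W by apply: contra vS; rewrite in_setU => ->.
have [vWn|vWn] := boolP [exists y in W, adj v y].
  have /existsP[y /andP[yW vy]] := vWn.
  by apply/existsP; exists y; rewrite in_setU yW.
(* Now [v] has no neighbour in [W], so it is not a leaf; not being in [W], it has no leaf neighbour.
   Hence [v] and all its neighbours lie in [R]. *)
have nbrW y : adj v y -> y \notin W.
  by move=> vy; apply: contra vWn => yW; apply/existsP; exists y; rewrite yW.
have vL : v \notin L.
  apply/negP=> vL; have := connected_degree_gt0 v connG n_gt1.
  rewrite card_gt0 => /set0Pn[y]; rewrite inE => vy.
  by case/negP: (nbrW y vy); apply: (WI y v); rewrite // adj_sym.
have nbrR y : adj v y -> y \in R.
  move=> vy; rewrite in_setC in_setU negb_or nbrW // andbT.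
  by apply: contra vW; apply: WI.
have vR : v \in R by rewrite in_setC in_setU negb_or vL.
have vr : v != r by apply: contraNneq vL => ->.
have deg2 : 1 < degree v.
  by rewrite ltn_neqAle eq_sym connected_degree_gt0 // andbT; rewrite inE in vL.
have [u vu du] := par v vr; have [w vw dw] := acyclic_child acG dP vr deg2.
have nbrC y : adj v y -> d y %% 3 = i -> [exists y in W :|: C, adj v y].
  move=> vy yi; apply/existsP; exists y.
  by rewrite in_setU [y \in C]inE nbrR // yi eqxx orbT.
(* The depths of [u], [v], [w] are consecutive, so one of the three is in class [i]; it is not [v],
   which lies outside [C]. *)
have vi : d v %% 3 != i.
  by apply: contra vS => vi; rewrite in_setU [v \in C]inE vR vi orbT.
have [ui|ui] := eqVneq (d u %% 3) i; first exact: nbrC vu ui.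
apply: nbrC vw _; lia.
Qed.

End Domination.

(** * Sharpness: the path on three vertices *)

Section Path3.
Local Open Scope nat_scope.

(* The centre of the path is [ord0]. *)
Definition path3_adj : rel 'I_3 := fun i j => (i == ord0) != (j == ord0).

Lemma path3_adj_sym : symmetric path3_adj.
Proof. by move=> i j; rewrite /path3_adj eq_sym. Qed.

Lemma path3_adj_irr : irreflexive path3_adj.
Proof. by move=> i; rewrite /path3_adj eqxx. Qed.

Definition path3 : sgraph := SGraph path3_adj_sym path3_adj_irr.

Lemma path3_tree : tree path3.
Proof.
split; first by rewrite /order_of card_ord.
  have conn0 (i : path3) : connect (@adj path3) (ord0 : 'I_3) i.
    have [->|i0] := eqVneq i (ord0 : 'I_3); first exact: connect0.
    by apply: connect1; rewrite /= /path3_adj eqxx (negPf i0).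
  move=> i j; apply: connect_trans (conn0 j).
  by rewrite (sym_connect_sym (@adj_sym path3)).
move=> c /andP[cyc uc]; rewrite ltn_neqAle.
have -> : size c <= 3 by rewrite -(card_uniqP uc) -[3]card_ord; apply: max_card.
(* Each edge switches between the centre and the other vertices, which is impossible around a closed
   walk of length 3. *)
rewrite andbT; apply: contraL cyc; case: c {uc} => [|x [|y [|z []]]] //= _.
by rewrite /path3_adj; do 3![case: (_ == ord0)].
Qed.

Lemma path3_leaves : leaves path3 = [set~ (ord0 : 'I_3)].
Proof.
apply/setP => i; rewrite !inE /degree.
have [->|i0] := eqVneq i (ord0 : 'I_3).
  have -> : @neighbors path3 (ord0 : 'I_3) = [set~ (ord0 : 'I_3)].
    by apply/setP => j; rewrite !inE /= /path3_adj eqxx; case: (j == _).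
  by rewrite cardsC1 card_ord.
have -> : neighbors i = [set (ord0 : 'I_3)].
  by apply/setP => j; rewrite !inE /= /path3_adj (negPf i0); case: (j == _).
by rewrite cards1.
Qed.

Lemma path3_support_vertices : support_vertices path3 = [set (ord0 : 'I_3)].
Proof.
apply/setP => i; rewrite !inE path3_leaves; apply/existsP/idP.
  case=> j; rewrite !inE /= /path3_adj => /andP[+ j0]; rewrite (negPf j0).
  by case: (i == _).
move/eqP->; exists (ord_max : 'I_3).
by rewrite !inE.
Qed.

(** The general bound reads [3 * domination_number path3 + 2 <= 5] here, and positivity gives the
    other inequality. *)
Lemma path3_domination_number : domination_number path3 = 1.
Proof.
have := tree_domination_bound path3_tree.
have := @domination_number_gt0 path3.
rewrite /order_of path3_leaves path3_support_vertices cardsC1 cards1 card_ord.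
by move=> /(_ isT) ? /(_ isT) ?; lia.
Qed.

End Path3.

(** The condition [2 <= n] excludes the one-vertex tree, where the left side is 1 and the right side
    1/3. *)
Theorem theorem4p3 :
  (forall (T : sgraph) (n l s : nat),
     tree T -> (2 <= n)%N ->
     order_of T = n -> #|leaves T| = l -> #|support_vertices T| = s ->
     (domination_number T)%:R <= (n%:R - l%:R + 2%:R * s%:R) / 3%:R :> rat)
  /\
  (exists T : sgraph,
     [/\ tree T, (2 <= order_of T)%N
       & (domination_number T)%:R =
         ((order_of T)%:R - #|leaves T|%:R + 2%:R * #|support_vertices T|%:R)
           / 3%:R :> rat]).
Proof.
split=> [T n l s treeT n_gt1 nE <- <-|].
  rewrite -nE in n_gt1 *; have := tree_domination_bound treeT n_gt1.
  by rewrite -(ler_nat rat) 2!natrD 2!natrM; lra.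
exists path3; split; first exact: path3_tree.
  by rewrite /order_of card_ord.
rewrite path3_domination_number /order_of path3_leaves path3_support_vertices.
by rewrite cardsC1 cards1 card_ord /=; lra.
Qed.
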